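(* Let $p(z)$ be a nonzero Hilbert polynomial of degree $d$, written as $p(z)=\sum_{i=0}^{d}\left[\binom{z+i}{i+1}-\binom{z+i-b_i}{i+1}\right]$ with integers $b_0\ge b_1\ge\cdots\ge b_d>0$. Then the number of saturated strongly stable ideals $I$ of $R=K[x_0,\ldots,x_n]$ such that $R/I$ has Hilbert polynomial $p(z)$ is the same for all $n\ge b_0+d-1$.
   Context: $K$ is an arbitrary field. ''Hilbert polynomial'' means the Hilbert polynomial of a standard graded $K$-algebra; every nonzero one can be written uniquely in the displayed form. A monomial ideal $I\subset R=K[x_0,\ldots,x_n]$ is strongly stable if for every monomial $x^A\in I$ and every $x_j\mid x^A$ we have $\frac{x_i}{x_j}x^A\in I$ whenever $0\le i<j$. A strongly stable ideal is saturated iff no minimal monomial generator is divisible by $x_n$. *)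

(* Defs.v *)
From HB Require Import structures.
From mathcomp Require Import all_boot all_order all_algebra.
From mathcomp Require Import boolp classical_sets functions cardinality.
From mathcomp Require Import mpoly.

Set Implicit Arguments.
Unset Strict Implicit.
Unset Printing Implicit Defensive.

Import Order.TTheory GRing.Theory Num.Theory.

Local Open Scope classical_set_scope.
Local Open Scope ring_scope.

(* Unlike [idealr_closed] of ring_quotient.v, this includes the unit ideal. *)
Definition is_ideal (A : comNzRingType) (I : set A) : Prop :=
  [/\ I 0,
      forall f g, I f -> I g -> I (f + g)
    & forall f g, I g -> I (f * g)].

Definition ideal_gen (A : comNzRingType) (S : set A) : set A :=
  smallest (@is_ideal A) S.

Section PolynomialRing.
Context (K : fieldType) (n : nat).
(* R = K[x_0, ..., x_n] has n + 1 variables. *)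
Local Notation R := {mpoly K[n.+1]}.
Implicit Types I : set R.

Definition homogeneous_ideal I : Prop :=
  is_ideal I /\ forall f t, I f -> I (pihomog mdeg t f).

Definition monomial_ideal I : Prop :=
  exists S : set 'X_{1..n.+1}, I = ideal_gen [set 'X_[m] | m in S].

(* The exponent [m - U_(j) + U_(i)] is that of (x_i / x_j) x^m: the subtraction
   on exponents is truncated, but m j > 0. *)
Definition strongly_stable I : Prop :=
  monomial_ideal I /\
  forall (m : 'X_{1..n.+1}) (i j : 'I_n.+1),
    I 'X_[m] -> (0 < m j)%N -> (i < j)%N -> I 'X_[m - U_(j) + U_(i)].

(* The k-th power of the irrelevant ideal (x_0, ..., x_n). *)
Definition irrelevant_pow (k : nat) : set R :=
  ideal_gen [set 'X_[m] | m in [set m : 'X_{1..n.+1} | mdeg m = k]].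

Definition saturation I : set R :=
  [set f | exists k, forall g, irrelevant_pow k g -> I (g * f)].

Definition saturated I : Prop := saturation I = I.

(* For an ideal I there is exactly one such subspace of R_t; the default value
   0 is only reached when I is not an ideal. *)
Definition graded_piece I (t : nat) : {vspace dhomog n.+1 K t} :=
  xget 0%VS [set U : {vspace dhomog n.+1 K t} |
    forall f : dhomog n.+1 K t, f \in U <-> I (mpoly_of_dhomog f)].

(* dim_K (R / I)_t = dim_K R_t - dim_K I_t, for I homogeneous. *)
Definition hilbert_function I (t : nat) : nat :=
  (\dim (fullv : {vspace dhomog n.+1 K t}) - \dim (graded_piece I t))%N.

Definition quotient_hilbert_poly I (p : {poly rat}) : Prop :=
  exists t0 : nat, forall t : nat, (t0 <= t)%N ->
    p.[t%:R] = (hilbert_function I t)%:R.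

End PolynomialRing.

(* A standard graded K-algebra is, up to isomorphism, a quotient of some
   K[x_0, ..., x_m] by a homogeneous ideal. *)
Definition is_hilbert_poly (K : fieldType) (p : {poly rat}) : Prop :=
  exists (m : nat) (J : set {mpoly K[m.+1]}),
    homogeneous_ideal J /\ quotient_hilbert_poly J p.

(* The binomial coefficient q (q - 1) ... (q - k + 1) / k! of a polynomial q. *)
Definition binomial_poly (q : {poly rat}) (k : nat) : {poly rat} :=
  (k`!%:R)^-1 *: \prod_(j < k) (q - (j : nat)%:R%:P).

(* Main.v *)
Require Import Defs.
From mathcomp Require Import all_boot all_order all_algebra.
From mathcomp Require Import boolp classical_sets functions cardinality.
From mathcomp Require Import mpoly.
From mathcomp Require Import zify ring.

Set Implicit Arguments.
Unset Strict Implicit.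
Unset Printing Implicit Defensive.

Import Order.TTheory GRing.Theory Num.Theory.

Local Open Scope classical_set_scope.
Local Open Scope card_scope.
Local Open Scope ring_scope.

(* The standard monomials of a saturated strongly stable ideal I are a disjoint
   union of cones u * K[x_(n-k), ..., x_n], so its Hilbert function is a sum of
   terms C(t - deg u + k, k).  Strong stability makes the degrees gap free: below a
   cone (k, deg u) every smaller degree occurs with some k' >= k.  Pascal's rule then
   rewrites the sum, level by level from the largest k, into the form
   sum_i C(t + i, i + 1) - C(t + i - b_i, i + 1) without ever losing a cone; the b_i
   being determined by the polynomial, there are at most b_0 cones, and k <= d.
   If x_0 is not in I, the values n + 1 and 1 of the Hilbert function at 1 and 0 force
   n + 1 <= b_0 + d.  So for n >= b_0 + d every such I contains x_0, and killing x_0 is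
   a bijection onto the ideals for n - 1.  There are finitely many ideals for each n
   since I is generated in degrees at most b_0. *)

(** * Saturated strongly stable sets of exponent lists *)

(* A monomial of K[x_0, ..., x_n] is encoded by the list of its n + 1 exponents,
   and only the values of [S] on lists of that length matter. *)
Record ssat (n : nat) (S : pred (seq nat)) : Prop := Ssat {
  ssat_up : forall m i, size m = n.+1 -> (i <= n)%N -> S m -> S (incr_nth m i);
  ssat_move : forall m i j, size m = n.+1 -> (i < j)%N -> (j <= n)%N ->
    S (incr_nth m j) -> S (incr_nth m i);
  ssat_sat : forall m, size m = n.+1 -> S (incr_nth m n) -> S m
}.

Definition slice (S : pred (seq nat)) (a : nat) : pred (seq nat) :=
  fun m => S (a :: m).

Lemma ssat_slice n S a : ssat n.+1 S -> ssat n (slice S a).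
Proof.
move=> [up mv st]; split; rewrite /slice.
- by move=> m i sm le_in Sm; apply: (up (a :: m) i.+1); rewrite /= ?sm.
- move=> m i j sm lt_ij le_jn Sm.
  by apply: (mv (a :: m) i.+1 j.+1); rewrite /= ?sm.
- by move=> m sm Sm; apply: (st (a :: m)); rewrite /= ?sm.
Qed.

Lemma ssat_head n S a a' m : ssat n S -> size m = n -> (a <= a')%N ->
  S (a :: m) -> S (a' :: m).
Proof.
move=> sS sm /subnKC <-; elim: (a' - a)%N => [|k IH] Sm; first by rewrite addn0.
by rewrite addnS; apply: (ssat_up (m := _ :: m) (i := 0) sS) => /=; auto; rewrite sm.
Qed.

Lemma ssat_tail n S a m : ssat n S -> size m = n ->
  S (a :: nseq n 0%N) -> S (a :: m).
Proof.
elim: n S a m => [|n IH] S a m sS; first by case: m.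
case: m => // a' m [sm] Sm.
apply: (IH (slice S a)) => //; first exact: ssat_slice.
by apply: (ssat_head (ssat_slice a sS) _ (leq0n _)); rewrite ?size_nseq.
Qed.

Lemma exists_incr_nth (m : seq nat) : (0 < sumn m)%N -> exists i m',
  [/\ (i < size m)%N, size m' = size m, m = incr_nth m' i & sumn m = (sumn m').+1].
Proof.
elim: m => //= -[|a] m IH /=.
  move=> /IH [i [m' [lti sm -> Em]]]; exists i.+1, (0%N :: m') => /=.
  by rewrite -sm in lti *; rewrite size_incr_nth lti.
by move=> _; exists 0%N, (a :: m); rewrite /= addSn.
Qed.

(** Each factor [x_j] with [j > 0] is traded for [x_0] by [ssat_move]; hence a nonempty [S] contains
    a power of [x_0]. *)
Lemma ssat_pure n S m : ssat n S -> size m = n.+1 -> S m ->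
  S (sumn m :: nseq n 0%N).
Proof.
move=> sS; case: m => // a m [sm] Sm /=.
have [k Ek] : exists k, k = sumn m by exists (sumn m).
elim: k a m sm Ek Sm => [|k IH] a m sm Ek Sm.
  rewrite -Ek addn0; suff <- : m = nseq n 0%N by [].
  rewrite -sm; elim: m {sm Sm} Ek => //= -[|//] m IH.
  by rewrite add0n => /IH {1}->.
have /exists_incr_nth [i [m' [lti sm' Em sumE]]] : (0 < sumn m)%N by rewrite -Ek.
rewrite sumE addnS -addSn; apply: IH; rewrite ?sm' //.
  by move: Ek; rewrite sumE => -[].
apply: (ssat_move (m := a :: m') (i := 0) (j := i.+1) sS) => //=.
- by rewrite sm' sm.
- by rewrite -sm.
- by rewrite -Em.
Qed.

(** * Monomials of a given degree *)

Fixpoint monomials (n t : nat) : seq (seq nat) :=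
  if n is n'.+1 then
    flatten [seq [seq a :: m | m <- monomials n' (t - a)] | a <- iota 0 t.+1]
  else [:: [:: t]].

Lemma monomialsS n t : monomials n.+1 t =
  flatten [seq [seq a :: m | m <- monomials n (t - a)] | a <- iota 0 t.+1].
Proof. by []. Qed.

Lemma mem_monomials n t m :
  (m \in monomials n t) = (size m == n.+1) && (sumn m == t).
Proof.
elim: n t m => [|n IH] t m.
  case: m => [|a [|b m]]; rewrite /= ?inE ?addn0 //; last by apply/eqP.
  by apply/eqP/eqP => [[]//|->].
rewrite monomialsS; apply/flatten_mapP/andP => [[a]|].
  rewrite mem_iota => /andP [_ lta] /mapP [m' + ->].
  rewrite IH /= eqSS => /andP [-> /eqP ->]; split=> //; apply/eqP; lia.
case: m => [[]//|a m] /= [/eqP[sm] /eqP Em]; exists a.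
  rewrite -[_ :: iota 1 t]/(iota 0 t.+1) mem_iota; lia.
apply/mapP; exists m => //; rewrite IH sm eqxx /=; apply/eqP; lia.
Qed.

Lemma uniq_monomials n t : uniq (monomials n t).
Proof.
elim: n t => //= n IH t.
apply: (allpairs_uniq_dep (f := fun a m => a :: m) (s := iota 0 t.+1)
   (t := fun a => monomials n (t - a))) => //.
- exact: iota_uniq.
- by move=> [a m] [a' m'] _ _ /= [-> ->].
Qed.

(** Summing over the exponent of [x_0] gives the hockey-stick identity, proved by induction on
    [t]. *)
Lemma size_monomials n t : size (monomials n t) = 'C(t + n, n).
Proof.
elim: n t => [|n IH] t; first by rewrite bin0.
rewrite monomialsS size_flatten /shape -map_comp sumnE big_map.
under eq_bigr do rewrite /= size_map IH.
rewrite -[X in bigop _ X _]/(index_iota 0 t.+1).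
elim: t => [|t IHt]; first by rewrite big_nat1 subn0 !add0n !binn.
rewrite big_nat_recl // IHt subn0 -addSnnS.
have -> : (t.+1 + n.+1 = (t.+1 + n).+1)%N by rewrite addnS.
by rewrite binS addnC.
Qed.

(** * Cone decompositions *)

(** The Hilbert function of the quotient by the monomial ideal that [S] encodes. *)
Definition std_count (n : nat) (S : pred (seq nat)) (t : nat) : nat :=
  count (predC S) (monomials n t).

Lemma std_count_slice n S t : std_count n.+1 S t =
  (\sum_(0 <= a < t.+1) std_count n (slice S a) (t - a))%N.
Proof.
rewrite /std_count monomialsS count_flatten sumnE !big_map.
by apply: eq_bigr => a _; rewrite count_map.
Qed.

Lemma std_count_empty n (S : pred (seq nat)) t :
  (forall m, size m = n.+1 -> ~~ S m) -> std_count n S t = 'C(t + n, n).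
Proof.
move=> S0; rewrite -size_monomials; apply/eqP; rewrite -all_count.
by apply/allP => m; rewrite mem_monomials => /andP [/eqP /S0].
Qed.

Lemma std_count_full n (S : pred (seq nat)) t :
  (forall m, size m = n.+1 -> S m) -> std_count n S t = 0%N.
Proof.
move=> S1; apply/eqP; rewrite eqn0Ngt -has_count; apply/hasPn => m.
by rewrite mem_monomials => /andP [/eqP /S1 /= ->].
Qed.

Lemma eq_std_count n (S S' : pred (seq nat)) t : (forall m, size m = n.+1 -> S m = S' m) ->
  std_count n S t = std_count n S' t.
Proof.
move=> eqS; apply: eq_in_count => m.
by rewrite mem_monomials /= => /andP [/eqP /eqS ->].
Qed.

(** Asking for [k <= k'] makes the degrees of the largest cones closed downwards, as [lower_level]
    requires. *)
Definition gap_free (L : seq (nat * nat)) : Prop :=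
  forall k e s, (k, e) \in L -> (s < e)%N -> exists2 k', (k <= k')%N & (k', s) \in L.

(** The Hilbert function of one cone. Without the test, truncated subtraction would give [1] below
    the apex. *)
Definition cone_count (x : nat * nat) (t : nat) : nat :=
  if (x.2 <= t)%N then 'C(t - x.2 + x.1, x.1) else 0%N.

(* [L] records the pairs [(k, deg u)] of a Stanley decomposition of the standard
   monomials into cones [u * K[x_(n-k), ..., x_n]]. *)
Record cone_decomposition n (S : pred (seq nat)) (L : seq (nat * nat)) : Prop :=
  ConeDecomposition {
  cone_std_count : forall t, std_count n S t = (\sum_(x <- L) cone_count x t)%N;
  cone_gap_free : gap_free L;
  cone_gens : forall B, (forall x, x \in L -> (x.2 < B)%N) ->
    forall m, size m = n.+1 -> S m ->
    exists m', [/\ S m', (sumn m' <= B)%N & all2 leq m' m];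
  cone_dim : forall x, x \in L -> (x.1 <= n)%N /\
    forall m, size m = x.1.+1 -> ~~ S (nseq (n - x.1) 0%N ++ m);
  cone_apex : ~~ S (nseq n.+1 0%N) -> exists2 k', (k', 0%N) \in L &
    forall k, (k' < k <= n)%N ->
      exists2 m, size m = k.+1 & S (nseq (n - k) 0%N ++ m)
}.

Lemma cone_decomposition_empty n (S : pred (seq nat)) : (forall m, size m = n.+1 -> ~~ S m) ->
  cone_decomposition n S [:: (n, 0%N)].
Proof.
move=> S0; split.
- by move=> t; rewrite std_count_empty // big_seq1 /cone_count /= subn0.
- by move=> k e s; rewrite inE => /eqP [_ ->].
- by move=> B _ m /S0 /negP.
- move=> x; rewrite inE => /eqP -> /=; split=> // m sm.
  by rewrite subnn; exact: S0.
- move=> _; exists n; first by rewrite inE.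
  by move=> k; case: ltngtP => //; lia.
Qed.

Lemma all2_leq_nseq0 m k : size m = k -> all2 leq (nseq k 0%N) m.
Proof. by move<-; elim: m => //= a m ->. Qed.

Lemma cone_decomposition_full n (S : pred (seq nat)) : ssat n S -> S (nseq n.+1 0%N) ->
  cone_decomposition n S [::].
Proof.
move=> sS S1.
have Sall m : size m = n.+1 -> S m.
  case: m => // a m [sm]; apply: (ssat_tail sS sm).
  by apply: (ssat_head sS _ (leq0n _) S1); rewrite size_nseq.
split=> //.
- by move=> t; rewrite big_nil std_count_full.
- move=> B _ m sm _; exists (nseq n.+1 0%N); split=> //.
    by rewrite sumn_nseq mul0n.
  exact: (all2_leq_nseq0 sm).
- by rewrite S1.
Qed.

(** Here [x_0^A] is the least power of [x_0] in [S]. Slices from [A] on are full; the cones of a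
    slice [a < A] are multiplied by [x_0^a], which adds [a] to the degree and keeps [k]. The fields
    [cone_dim] and [cone_apex] serve to fill degrees across different slices. *)
Lemma cone_decomposition_slices n (S : pred (seq nat)) A (L : nat -> seq (nat * nat)) :
  ssat n.+1 S -> S (A :: nseq n.+1 0%N) ->
  (forall a, (a < A)%N -> ~~ S (a :: nseq n.+1 0%N)) ->
  (forall a, cone_decomposition n (slice S a) (L a)) ->
  cone_decomposition n.+1 S
    [seq (x.1, (x.2 + a)%N) | a <- iota 0 A, x <- L a].
Proof.
move=> sS SA SltA dL.
have S_geA a m : (A <= a)%N -> size m = n.+1 -> S (a :: m).
  move=> leAa sm; apply: (ssat_tail sS sm).
  by apply: (ssat_head sS _ leAa SA); rewrite size_nseq.
have mem_LL k e : reflect (exists a e', [/\ (a < A)%N, (k, e') \in L a & e = (e' + a)%N])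
    ((k, e) \in [seq (x.1, (x.2 + a)%N) | a <- iota 0 A, x <- L a]).
  apply: (iffP allpairsPdep) => /= [[a [[k' e'] [+ + [-> ->]]]]|[a [e' [ltaA Lx ->]]]].
    by rewrite mem_iota => /andP[_ ltaA] Lx; exists a, e'.
  by exists a, (k, e'); rewrite mem_iota.
have apex a : (a < A)%N -> exists2 k', (k', 0%N) \in L a &
    forall k, (k' < k <= n)%N ->
      exists2 m, size m = k.+1 & slice S a (nseq (n - k) 0%N ++ m).
  by move=> /SltA /(cone_apex (dL a)).
split.
- move=> t; rewrite std_count_slice big_allpairs_dep /=.
  have -> : (\sum_(a <- iota 0 A) \sum_(x <- L a) cone_count (x.1, (x.2 + a)%N) t =
      \sum_(0 <= a < A) if (a <= t)%N then std_count n (slice S a) (t - a) else 0)%N.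
    rewrite /index_iota subn0; apply: eq_bigr => a _; case: leqP => [leat|ltta].
      rewrite (cone_std_count (dL a)); apply: eq_bigr => x _; rewrite /cone_count /=.
      by rewrite [(x.2 + a)%N]addnC -leq_subRL // subnDA.
    rewrite big1 // => x _; rewrite /cone_count /= leqNgt.
    by rewrite (leq_trans ltta (leq_addl _ _)).
  (* Both sums are sums of [F], cut at [A] or after [t], and [F] vanishes beyond either bound. *)
  pose F a := if (a <= t)%N then std_count n (slice S a) (t - a) else 0%N.
  have F0 a : (A <= a)%N || (t.+1 <= a)%N -> F a = 0%N.
    rewrite /F; case: (leqP a t) => //= leat; rewrite orbF => leAa.
    by rewrite std_count_full // => m sm; exact: S_geA.
  have sumF0 c c' : (A <= c)%N || (t.+1 <= c)%N -> (\sum_(c <= a < c') F a = 0)%N.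
    move=> lec; rewrite big_nat big1 // => a /andP [leca _]; apply: F0.
    by case/orP: lec => /leq_trans-/(_ _ leca) ->; rewrite ?orbT.
  transitivity (\sum_(0 <= a < maxn A t.+1) F a)%N.
    rewrite (big_cat_nat (n := t.+1) (p := maxn A t.+1)) ?leq_maxr //=.
    rewrite (sumF0 t.+1) ?leqnn ?orbT // addn0 big_nat [RHS]big_nat.
    by apply: eq_bigr => a /andP[_ lta]; rewrite /F -ltnS lta.
  by rewrite (big_cat_nat (n := A) (p := maxn A t.+1)) ?leq_maxl //= (sumF0 A) ?leqnn // addn0.
- move=> k e s /mem_LL [a [e' [ltaA Lx ->]]] lts.
  (* If [a <= s], the degree is found inside slice [a]; otherwise it is that of the apex cone of
     slice [s]. *)
  have [leas|ltsa] := leqP a s.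
    have [|k' lekk' Lk'] := cone_gap_free (dL a) (s := (s - a)%N) Lx; first by lia.
    by exists k' => //; apply/mem_LL; exists a, (s - a)%N; split=> //; lia.
  have ltsA : (s < A)%N := ltn_trans ltsa ltaA.
  (* If the cone of x_0^s were smaller than that of [(k, e)], its maximality would
     put a multiple of the latter into [S]. *)
  have [k' Lk' k'max] := apex _ ltsA; exists k'; last first.
    by apply/mem_LL; exists s, 0%N.
  have [le_kn /= Sk] := cone_dim (dL a) Lx.
  rewrite leqNgt; apply/negP => ltk.
  have [|m sm Sm] := k'max k; first by rewrite ltk.
  have /negP := Sk _ sm; apply; rewrite /slice.
  by apply: (ssat_head sS _ (ltnW ltsa) Sm); rewrite size_cat size_nseq sm addnS subnK.
- move=> B ltB [//|a m] [sm] Sam.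
  (* If [A > 0], slice [A - 1] has a cone with apex [1], which contributes the degree
     [A - 1 < B]. *)
  have leAB : (A <= B)%N.
    case: A SltA apex mem_LL ltB {SA S_geA} => // A _ apex mem_LL ltB.
    have [k Lk _] := apex A (ltnSn _).
    by have := ltB (k, A); apply; apply/mem_LL; exists A, 0%N.
  (* The divisor sought is [x_0^A], or [x_0^a] times one from slice [a], whose cones have degrees
     below [B - a]. *)
  have [leAa|ltaA] := leqP A a.
    exists (A :: nseq n.+1 0%N); split.
    - exact: SA.
    - by rewrite /= sumn_nseq mul0n !addn0.
    - by apply/andP; split=> //; exact: (all2_leq_nseq0 sm).
  have [x Lx|m' [Sm' le_m' m'm]] := cone_gens (dL a) (B := (B - a)%N) _ sm Sam.
    rewrite ltn_subRL addnC; apply: (ltB (x.1, (x.2 + a)%N)).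
    by apply/mem_LL; exists a, x.2; rewrite -surjective_pairing.
  exists (a :: m'); split=> //=; last by rewrite leqnn.
  by rewrite -leq_subRL // (leq_trans (ltnW ltaA)).
- move=> [k e] /mem_LL [a [e' [ltaA Lx ->]]] /=.
  have [/= le_kn Sk] := cone_dim (dL a) Lx; split; first exact: leqW.
  move=> m sm; apply: contraNN (Sk m sm); rewrite subSn //= => S0m.
  by apply: (ssat_head sS _ (leq0n a) S0m); rewrite size_cat size_nseq sm addnS subnK.
- move=> S1; have A_gt0 : (0 < A)%N.
    by case: A SA {SltA S_geA mem_LL apex} => // S1'; rewrite S1' in S1.
  have [k' Lk' k'max] := apex _ A_gt0; exists k'.
    by apply/mem_LL; exists 0%N, 0%N.
  (* For [k = n + 1] all variables are allowed, and [x_0^A] is the required element of [S]. *)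
  move=> k /andP [ltk]; rewrite leq_eqVlt => /orP [/eqP ->|].
    by exists (A :: nseq n.+1 0%N); rewrite /= ?size_nseq // subnn.
  rewrite ltnS => le_kn; have [|m sm Sm] := k'max k; first by rewrite ltk.
  by exists m => //; rewrite subSn.
Qed.

(** Induction on the number of variables. In one variable, saturation leaves only the empty and the
    full set; in more, a nonempty [S] contains a power of [x_0] and its slices are reassembled. *)
Lemma ssat_cone_decomposition n (S : pred (seq nat)) : ssat n S ->
  exists L, cone_decomposition n S L.
Proof.
elim: n S => [|n IH] S sS.
  have [S0|S0] := boolP (S [:: 0%N]).
    by exists [::]; exact: cone_decomposition_full.
  exists [:: (0, 0)%N]; apply: cone_decomposition_empty => -[//|a [|//]] _.
  elim: a => // a; apply: contraNN; exact: (ssat_sat (m := [:: a]) sS).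
have [[m sm Sm]|S0] := pselect (exists2 m, size m = n.+2 & S m); last first.
  exists [:: (n.+1, 0%N)]; apply: cone_decomposition_empty => m sm.
  by apply/negP => Sm; apply: S0; exists m.
have exA : exists A, S (A :: nseq n.+1 0%N).
  by exists (sumn m); exact: ssat_pure.
have /choice [L dL] a : exists La, cone_decomposition n (slice S a) La.
  by apply: IH; exact: ssat_slice.
case: (ex_minnP exA) => A SA minA.
exists [seq (x.1, (x.2 + a)%N) | a <- iota 0 A, x <- L a].
apply: cone_decomposition_slices => // a ltaA.
by apply: contraL ltaA => /minA; rewrite -leqNgt.
Qed.

(** * Hilbert polynomials of cone decompositions *)

Lemma falling_recl (q : {poly rat}) k :
  \prod_(j < k.+1) (q - (j : nat)%:R%:P) = q * \prod_(j < k) (q - 1 - (j : nat)%:R%:P).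
Proof.
rewrite big_ord_recl subr0; congr (_ * _); apply: eq_bigr => j _.
by rewrite lift0 -natr1 polyCD polyC1 opprD addrA addrAC.
Qed.

Lemma binomial_poly_pascal (q : {poly rat}) k :
  binomial_poly q k.+1 = binomial_poly (q - 1) k.+1 + binomial_poly (q - 1) k.
Proof.
rewrite /binomial_poly falling_recl big_ord_recr /=.
set r := \prod_(j < k) _.
have -> : (k`!%:R : rat)^-1 *: r = (k.+1`!%:R : rat)^-1 *: (k.+1%:R%:P * r).
  rewrite mul_polyC scalerA factS natrM invfM -mulrA mulrC -mulrA mulfV ?mulr1 //.
  by rewrite pnatr_eq0.
rewrite -scalerDr; congr (_ *: _); rewrite -natr1 polyCD polyC1.
by rewrite [in RHS]mulrC -mulrDl; congr (_ * _); rewrite addrA subrK addrNK.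
Qed.

Lemma binomial_poly_comp (q r : {poly rat}) k :
  binomial_poly q k \Po r = binomial_poly (q \Po r) k.
Proof.
rewrite /binomial_poly comp_polyZ rmorph_prod; congr (_ *: _).
by apply: eq_bigr => j _; rewrite rmorphB /= comp_polyC.
Qed.

Lemma binomial_poly_nat (q : {poly rat}) k x (m : nat) : q.[x] = m%:R ->
  (binomial_poly q k).[x] = 'C(m, k)%:R.
Proof.
move=> qx; rewrite /binomial_poly hornerZ horner_prod.
under eq_bigr do rewrite hornerD hornerN hornerC qx.
have -> : \prod_(j < k) (m%:R - (j : nat)%:R) = (m ^_ k)%:R :> rat.
  elim: k => [|k IH]; first by rewrite big_ord0 ffactn0.
  rewrite big_ord_recr IH ffactnSr natrM /=.
  have [lekm|ltmk] := leqP k m; first by rewrite natrB.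
  by rewrite ffact_small // !mul0r.
by rewrite -bin_ffact natrM mulrC mulfK // pnatr_eq0 -lt0n fact_gt0.
Qed.

(** * Polynomials of cones and levels *)

(** For a natural number [c] this is the sum of [cone_poly i s] over [1 <= s <= c], by
    [level_polyS]. *)
Definition level_poly (i : nat) (c : int) : {poly rat} :=
  binomial_poly ('X + i%:R%:P) i.+1 - binomial_poly ('X + i%:R%:P - c%:~R%:P) i.+1.

Definition cone_poly (k e : nat) : {poly rat} :=
  binomial_poly ('X + k%:R%:P - e%:R%:P) k.

Lemma level_poly0 i : level_poly i 0 = 0.
Proof. by rewrite /level_poly subr0 subrr. Qed.

Lemma level_polyS i (c : nat) :
  level_poly i c.+1%:Z = level_poly i c%:Z + cone_poly i c.+1.
Proof.
rewrite /level_poly /cone_poly !pmulrn.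
rewrite [X in _ - X + _]binomial_poly_pascal.
rewrite (_ : 'X + i%:R%:P - c%:~R%:P - 1 = 'X + i%:R%:P - c.+1%:R%:P); last first.
  by rewrite -natr1 polyCD opprD addrA.
by rewrite opprD addrA subrK.
Qed.

(** A cone is the disjoint union of its multiple by its first variable and of the cone on the
    remaining variables. *)
Lemma cone_polyS k e : cone_poly k.+1 e = cone_poly k.+1 e.+1 + cone_poly k e.
Proof.
rewrite /cone_poly binomial_poly_pascal.
congr (binomial_poly _ _ + binomial_poly _ _).
  by rewrite -(natr1 e) polyCD opprD addrA.
by rewrite -(natr1 k) polyCD addrAC addrA addrK.
Qed.

Lemma cone_poly0 e : cone_poly 0 e = 1.
Proof. by rewrite /cone_poly /binomial_poly big_ord0 invr1 scale1r. Qed.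

Lemma level_poly_0 (c : int) : level_poly 0 c = c%:~R%:P.
Proof.
rewrite /level_poly /binomial_poly !big_ord1 invr1 !scale1r !subr0.
by rewrite opprD opprK addrA subrr add0r.
Qed.

(** Repeated splitting raises the apex to degree [j + 1] and leaves one smaller cone in each degree
    passed. *)
Lemma cone_polyE k e j : (e <= j)%N ->
  cone_poly k.+1 e = cone_poly k.+1 j.+1 + \sum_(s <- iota e (j.+1 - e)) cone_poly k s.
Proof.
move=> /subnKC <-; rewrite -addnS addKn; elim: (j - e)%N => [|n IH].
  by rewrite addn1 big_seq1 cone_polyS.
rewrite -[n.+2]addn1 iotaD big_cat big_seq1 IH /= addn1 !addnS.
by rewrite [cone_poly k.+1 (e + n).+1]cone_polyS -!addrA [X in _ + X]addrC.
Qed.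

(* In decreasing order of degree, the entry [e] followed by [j] others satisfies [e <= j], and
   [cone_poly k.+1 e] is the [j]-th increment of [level_poly k.+1] plus the lower
   cones of degrees [e, ..., j]. *)
Lemma lower_level k M : (forall e s, e \in M -> (s < e)%N -> s \in M) ->
  exists M', [/\ \sum_(e <- M) cone_poly k.+1 e =
                   level_poly k.+1 (size M)%:Z + \sum_(e <- M') cone_poly k e,
                 forall s, (s \in M') = (s < size M)%N
               & forall e, e \in M -> (e < size M)%N].
Proof.
wlog sM : M / sorted geq M => [wl M_closed|].
  have [|e s|M'] := wl (sort geq M).
  - by apply: sort_sorted => a b; rewrite /geq /= leq_total.
  - by rewrite !mem_sort; exact: M_closed.
  rewrite size_sort (perm_big M) ?perm_sort //= => -[EM EM' ltM].
  by exists M'; split=> // e; rewrite -(mem_sort geq); exact: ltM.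
elim: M sM => [_ _|x M IH].
  by exists [::]; split=> //; rewrite !big_nil level_poly0 addr0.
rewrite /sorted -/(path _ _ _) (path_sortedE (leT := geq)); last first.
  by move=> a b c /= lab lbc; exact: leq_trans lbc lab.
move=> /andP [/allP geM sM] M_closed.
have [|M' [EM EM' ltM]] := IH sM.
  move=> e s Me lts; have := M_closed e s; rewrite !inE Me orbT => /(_ isT lts).
  by case/orP => // /eqP Es; have := geM _ Me; rewrite /= -Es leqNgt lts.
(* The largest entry [x] comes with all smaller degrees, so the list has at least [x + 1]
   entries. *)
have lex : (x <= size M)%N.
  suff /(uniq_leq_size (iota_uniq 0 x.+1)) : {subset iota 0 x.+1 <= x :: M}.
    by rewrite size_iota.
  move=> s; rewrite mem_iota /= add0n ltnS leq_eqVlt => /orP [/eqP ->|].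
    by rewrite inE eqxx.
  by apply: M_closed; rewrite inE eqxx.
(* Splitting [x] up to degree [size M + 1] yields the next increment of the level; the smaller cones
   left over, together with [M'], cover exactly the degrees below the new size. *)
exists (iota x ((size M).+1 - x) ++ M'); split.
- rewrite big_cons big_cat (cone_polyE k lex) EM level_polyS.
  by rewrite addrACA [cone_poly _ _ + _]addrC.
- move=> s; rewrite mem_cat mem_iota EM' subnKC; last exact: leqW.
  have [_|ltsx] := leqP x s; first by apply: orb_idr => /leqW.
  have lts := leq_trans ltsx lex.
  by rewrite lts orbT; apply/esym; exact: (leqW lts).
- by move=> e; rewrite inE => /orP [/eqP ->|/ltM /ltnW] //=; rewrite ltnS.
Qed.

(** Induction on the top index: [lower_level] turns the largest cones into one level and smaller
    cones, at least as many as were removed. The bound on counts records that no cone is lost. *)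
Lemma cones_to_levels D (L : seq (nat * nat)) :
  (forall x, x \in L -> (x.1 <= D)%N) -> gap_free L ->
  exists c : nat -> nat,
    \sum_(x <- L) cone_poly x.1 x.2 = \sum_(i < D.+1) level_poly i (c i)%:Z /\
    forall k, (k <= D)%N -> (count (fun x => k <= x.1)%N L <= c k)%N.
Proof.
elim: D L => [|D IH] L leL gfL.
  (* For [D = 0] every cone contributes the constant [1]. *)
  exists (fun=> size L); split=> [|k _]; last exact: count_size.
  rewrite big_ord1 level_poly_0 big_seq.
  under eq_bigr => x /leL; first by rewrite leqn0 => /eqP ->; rewrite cone_poly0; over.
  by rewrite -big_seq big_const_seq count_predT iter_addr addr0 -pmulrn polyC_natr.
pose M := [seq x.2 | x <- L & x.1 == D.+1].
have memM e : (e \in M) = ((D.+1, e) \in L).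
  apply/mapP/idP => [[[k e'] + ->]|Lx].
    by rewrite mem_filter /= => /andP [/eqP ->].
  by exists (D.+1, e); rewrite // mem_filter eqxx.
have [|M' [EM EM' ltM]] := @lower_level D M.
  move=> e s; rewrite !memM => Lx lts; have [k' lek' Lk'] := gfL _ _ _ Lx lts.
  by have /= := leL _ Lk' => lek; rewrite (_ : D.+1 = k') //; apply/eqP; rewrite eqn_leq lek' lek.
pose L' := [seq x <- L | x.1 != D.+1] ++ [seq (D, s) | s <- M'].
have memL' k e : ((k, e) \in L') =
    ((k != D.+1) && ((k, e) \in L)) || (k == D) && (e \in M').
  rewrite mem_cat mem_filter; congr (_ || _); apply/mapP/andP => /=.
    by move=> [s Ms [-> ->]].
  by move=> [/eqP -> Me]; exists e.
have [[k e]|k e s|c [Ec lec]] := IH L'.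
- rewrite memL' => /orP [/andP [neq /leL /=]|/andP[/eqP -> //]].
  by rewrite leq_eqVlt (negPf neq).
- rewrite memL' => /orP [/andP [neq Lx] lts|/andP[/eqP -> Me] lts].
    have [k' lek' Lk'] := gfL _ _ _ Lx lts.
    (* If the degree was filled by a removed cone [(D.+1, s)], then [s < size M] and [(D, s)] takes
       its place. *)
    have [Ek'|neqk'] := eqVneq k' D.+1; last by exists k'; rewrite ?memL' ?neqk' ?Lk'.
    exists D; last by rewrite memL' eqxx EM' ltM ?orbT // memM -Ek'.
    by have := leL _ Lx; rewrite /= leq_eqVlt (negPf neq).
  exists D => //; rewrite memL' eqxx EM' (ltn_trans lts) ?orbT //.
  by rewrite -EM'.
exists (fun i => if i == D.+1 then size M else c i); split.
  rewrite big_ord_recr /= eqxx (bigID (fun x => x.1 == D.+1)) /= addrC.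
  rewrite (eq_bigr (fun i : 'I_D.+1 => level_poly i (c i))); last first.
    by move=> i _; rewrite ltn_eqF.
  rewrite -Ec /L' big_cat /= big_filter -addrA; congr (_ + _).
  rewrite big_map addrC -EM /M big_map big_filter.
  by apply: eq_bigr => x /eqP ->.
(* [M'] contains every degree below [size M], so each removed cone is compensated in the count. *)
have leM : (size M <= size M')%N.
  rewrite -{1}(size_iota 0 (size M)); apply: uniq_leq_size; first exact: iota_uniq.
  by move=> s; rewrite mem_iota EM'.
move=> k; rewrite leq_eqVlt => /orP [/eqP ->|ltk].
  rewrite eqxx /M size_map size_filter; apply: eq_leq; apply: eq_in_count => x /leL /= lex.
  by rewrite eqn_leq lex.
rewrite ltn_eqF //; apply: leq_trans (lec k _); last by [].
rewrite /L' count_cat count_map count_filter.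
have -> : count (preim (fun s => (D, s)) (fun x => (k <= x.1)%N)) M' = size M'.
  by apply/eqP; rewrite -all_count; apply/allP => s _ /=.
apply: leq_trans (leq_add (leqnn _) leM); rewrite /M size_map size_filter.
rewrite -(count_predUI) /=; apply: leq_trans (leq_addr _ _).
by apply: sub_count => x /= ->; case: eqP.
Qed.

(** * Uniqueness of the coefficients [b_i] *)

(** The backward difference, which kills the level of index [0] and lowers every other index by
    one. *)
Definition poly_shift_sub (q : {poly rat}) := q - (q \Po ('X - 1)).

Lemma poly_shift_sub_level i c :
  poly_shift_sub (level_poly i.+1 c) = level_poly i c.
Proof.
rewrite /poly_shift_sub /level_poly rmorphB /= !binomial_poly_comp.
rewrite [X in X - _ - _]binomial_poly_pascal.
rewrite [X in _ - X - _]binomial_poly_pascal.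
rewrite !rmorphB !rmorphD /= comp_polyX !comp_polyC.
rewrite (_ : 'X + i.+1%:R%:P - 1 = 'X + i%:R%:P) -?natr1 ?polyCD ?polyC1; last by ring.
rewrite (_ : 'X - 1 + (i%:R%:P + 1) = 'X + i%:R%:P); last by ring.
rewrite (_ : 'X + (i%:R%:P + 1) - c%:~R%:P - 1 = 'X + i%:R%:P - c%:~R%:P); last by ring.
by ring.
Qed.

(** Differencing removes [c 0] and shifts the other coefficients, which agree by induction;
    cancelling them leaves the two constants. *)
Lemma level_poly_sum_inj D (c c' : nat -> int) :
  \sum_(i < D.+1) level_poly i (c i) = \sum_(i < D.+1) level_poly i (c' i) ->
  forall i, (i <= D)%N -> c i = c' i.
Proof.
have inj0 (a a' : int) : level_poly 0 a = level_poly 0 a' -> a = a'.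
  by rewrite !level_poly_0 => /polyC_inj /intr_inj.
elim: D c c' => [|D IH] c c'.
  by rewrite !big_ord1 => /inj0 ? [].
rewrite [LHS]big_ord_recl [RHS]big_ord_recl => Ec.
have step (a : nat -> int) : poly_shift_sub (level_poly (@ord0 D.+1) (a (@ord0 D.+1)) +
    \sum_(i < D.+1) level_poly (lift ord0 i) (a (lift ord0 i))) =
    \sum_(i < D.+1) level_poly i (a i.+1).
  rewrite /poly_shift_sub comp_polyD raddf_sum opprD addrACA -sumrB.
  rewrite level_poly_0 comp_polyC subrr add0r.
  by apply: eq_bigr => i _; rewrite lift0; exact: poly_shift_sub_level.
have Ec' : forall i, (i <= D)%N -> c i.+1 = c' i.+1.
  by apply: (IH (c \o succn) (c' \o succn)); rewrite -!step Ec.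
case=> [_|i]; last exact: Ec'.
apply: inj0; move: Ec; rewrite (eq_bigr (fun i : 'I_D.+1 => level_poly (lift ord0 i) (c' (lift ord0 i)))).
  exact: addIr.
by move=> i _; rewrite lift0 Ec' // -ltnS.
Qed.

Lemma poly_nat_inj (p q : {poly rat}) N :
  (forall t : nat, (N <= t)%N -> p.[t%:R] = q.[t%:R]) -> p = q.
Proof.
move=> eqpq; apply/eqP; rewrite -subr_eq0; apply/eqP.
set r := p - q; have [//|r0] := eqVneq r 0.
pose rs : seq rat := [seq t%:R | t <- iota N (size r)].
have rs_roots : all (root r) rs.
  apply/allP => _ /mapP [t + ->]; rewrite mem_iota => /andP[leNt _].
  by rewrite /root /r hornerD hornerN eqpq ?subrr.
have rs_uniq : uniq rs.
  by rewrite map_inj_uniq ?iota_uniq // => a b /eqP; rewrite eqr_nat => /eqP.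
by have := max_poly_roots r0 rs_roots rs_uniq; rewrite size_map size_iota ltnn.
Qed.

(** * Bounds on the number and the size of the cones *)

Lemma cone_poly_nat k e t : (e <= t)%N ->
  (cone_poly k e).[t%:R] = (cone_count (k, e) t)%:R.
Proof.
move=> leet; rewrite /cone_count leet; apply: binomial_poly_nat => /=.
by rewrite !hornerE natrD natrB // addrAC.
Qed.

(** The levels obtained from [L] must have the coefficients [b]. The count bound at index [0] limits
    [size L], and the zero coefficients above [d] exclude larger cones. *)
Lemma level_form_cone_bound n (S : pred (seq nat)) L d (b : 'I_d.+1 -> int)
    (p : {poly rat}) t0 :
  cone_decomposition n S L ->
  (forall t, (t0 <= t)%N -> p.[t%:R] = (std_count n S t)%:R) ->
  p = \sum_(i < d.+1) level_poly i (b i) ->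
  (size L)%:Z <= b ord0 /\ forall x, x \in L -> (x.1 <= d)%N.
Proof.
move=> dL pS pE.
(* Both forms are compared up to a common top index [D], with [b] padded by zeros, whose levels
   vanish. *)
pose D := maxn d (\max_(x <- L) x.1).
have leLD x : x \in L -> (x.1 <= D)%N.
  by move=> Lx; rewrite leq_max (leq_bigmax_seq _ Lx) ?orbT.
have [c [Ec lec]] := cones_to_levels leLD (cone_gap_free dL).
pose b' i := if insub i is Some j then b j else 0.
have EL : \sum_(x <- L) cone_poly x.1 x.2 = p.
  pose N := maxn t0 (\max_(x <- L) x.2).
  apply: (@poly_nat_inj _ _ N) => t; rewrite geq_max => /andP [let0 letL].
  rewrite pS // (cone_std_count dL) horner_sum natr_sum !big_seq.
  apply: eq_bigr => x Lx; rewrite cone_poly_nat -?surjective_pairing //.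
  by apply: leq_trans letL; exact: leq_bigmax_seq.
have {}pE : p = \sum_(i < D.+1) level_poly i (b' i).
  have le_dD : (d.+1 <= D.+1)%N by rewrite ltnS leq_maxl.
  rewrite pE (eq_bigr (fun i : 'I_d.+1 => level_poly i (b' i))); last first.
    by move=> i _; rewrite /b' valK.
  rewrite (big_ord_widen _ (fun i => level_poly i (b' i)) le_dD) big_mkcond.
  apply: eq_bigr => i _; case: ifP => // lti.
  by rewrite /b' insubF // level_poly0.
have Eb : forall i, (i <= D)%N -> (c i)%:Z = b' i.
  by apply: level_poly_sum_inj; rewrite -Ec EL.
split.
  have := lec 0%N (leq0n _); rewrite count_predT -lez_nat Eb //.
  by rewrite /b' (insubT (fun i => i < d.+1)%N (ltn0Sn d)) (_ : Sub _ _ = ord0) //; exact: val_inj.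
move=> x Lx; rewrite leqNgt; apply/negP => ltdx.
have := lec x.1 (leLD x Lx); have [] := Eb x.1 (leLD x Lx).
rewrite /b' insubF; last by rewrite ltnS leqNgt ltdx.
case=> ->; rewrite leqn0 eqn0Ngt -has_count => /hasPn /(_ x Lx) /=.
by rewrite leqnn.
Qed.

(** Every degree up to that of [x] occurs in [L]. *)
Lemma size_gt_gap_free L x : gap_free L -> x \in L -> (x.2 < size L)%N.
Proof.
case: x => k e gfL Lx /=.
suff /(uniq_leq_size (iota_uniq 0 e.+1)) : {subset iota 0 e.+1 <= [seq x.2 | x <- L]}.
  by rewrite size_iota size_map.
move=> s; rewrite mem_iota /= add0n ltnS leq_eqVlt => /orP [/eqP ->|lts].
  by apply/mapP; exists (k, e).
by have [k' _ Lk'] := gfL _ _ _ Lx lts; apply/mapP; exists (k', s).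
Qed.

(** Without [x_0], the set [S] has no monomial of degree at most [1], so the Hilbert function is [1]
    at [0] and [n + 1] at [1], too large for the given cones. *)
Lemma linear_form_of_cone_bound n (S : pred (seq nat)) L d :
  ssat n S -> cone_decomposition n S L ->
  (forall x, x \in L -> (x.1 <= d)%N) -> (size L + d <= n)%N ->
  S (1%N :: nseq n 0%N).
Proof.
move=> sS dL led; apply: contraTT => S1; rewrite -ltnNge.
have std_count_all t : (t <= 1)%N -> std_count n S t = 'C(t + n, n).
  move=> let1; rewrite -size_monomials; apply/eqP; rewrite -all_count; apply/allP => m.
  rewrite mem_monomials => /andP [/eqP sm /eqP Em] /=.
  apply: contra S1 => /(ssat_pure sS sm); rewrite Em => Sp.
  by apply: (ssat_head sS _ let1 Sp); rewrite size_nseq.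
have count0 : (\sum_(x <- L) cone_count x 0 = 1)%N.
  by rewrite -(cone_std_count dL) std_count_all // binn.
have count1 : (\sum_(x <- L) cone_count x 1 = n.+1)%N.
  by rewrite -(cone_std_count dL) std_count_all // add1n binSn.
rewrite -ltnS -count1 addnC.
(* In degree [1], the single cone with apex in degree [0] contributes at most [d + 1], any other at
   most [1]. *)
apply: (@leq_ltn_trans (\sum_(x <- L) (d * cone_count x 0 + 1)))%N.
  rewrite big_seq [X in (_ <= X)%N]big_seq; apply: leq_sum => -[k [|[|e]]] /led /= lek.
  - rewrite /cone_count /= !subn0 add0n binn add1n binSn muln1 addn1 ltnS //.
  - by rewrite /cone_count /= subnn add0n binn muln0.
  - by [].
by rewrite big_split -big_distrr /= count0 muln1 sum1_size ltnS.
Qed.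

(** * Monomial ideals and exponent lists *)

Definition exponents k (m : 'X_{1..k}) : seq nat := m.

Definition monomial_of k (s : seq nat) : 'X_{1..k} := [multinom nth 0%N s i | i < k].

Lemma size_exponents k (m : 'X_{1..k}) : size (exponents m) = k.
Proof. exact: size_tuple. Qed.

Lemma nth_exponents k (m : 'X_{1..k}) (i : 'I_k) : nth 0%N (exponents m) i = m i.
Proof. by rewrite [RHS](mnm_nth 0%N). Qed.

Lemma exponentsK k (m : 'X_{1..k}) : monomial_of k (exponents m) = m.
Proof. by apply/mnmP => i; rewrite mnmE nth_exponents. Qed.

Lemma monomial_ofK k s : size s = k -> exponents (monomial_of k s) = s.
Proof.
move=> ss; apply: (@eq_from_nth _ 0%N); rewrite size_exponents // => i lti.
by rewrite (nth_exponents _ (Ordinal lti)) mnmE.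
Qed.

Lemma sumn_exponents k (m : 'X_{1..k}) : sumn (exponents m) = mdeg m.
Proof. by rewrite sumnE. Qed.

Lemma monomial_of_incr k s (i : 'I_k) :
  monomial_of k (incr_nth s i) = (monomial_of k s + U_(i))%MM.
Proof.
by apply/mnmP => j; rewrite mnmDE mnm1E !mnmE nth_incr_nth addnC.
Qed.

Lemma exponents_incr k (m : 'X_{1..k}) (i : 'I_k) :
  exponents (m + U_(i))%MM = incr_nth (exponents m) i.
Proof.
rewrite -[m in LHS]exponentsK -monomial_of_incr monomial_ofK //.
by rewrite size_incr_nth size_exponents ltn_ord.
Qed.

Section MonomialIdeals.
Variables (K : fieldType) (k : nat).
Local Notation R := {mpoly K[k]}.

Definition support_ideal (P : 'X_{1..k} -> Prop) : set R :=
  [set f | forall m, m \in msupp f -> P m].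

Lemma up_closed_add (P : 'X_{1..k} -> Prop) :
  (forall m i, P m -> P (m + U_(i))%MM) -> forall m m', P m -> P (m + m')%MM.
Proof.
move=> upP m m'; have [e] := ubnP (mdeg m'); elim: e m m' => // e IH m m' lte Pm.
have [->|] := eqVneq m' 0%MM; first by rewrite addm0.
rewrite -mdeg_eq0 mdegE sum_nat_eq0 => /forallPn [i] /=.
rewrite -lep1mP => lei.
rewrite -(submK lei) addmA addmC addmA; apply: IH; last by rewrite addmC; exact: upP.
by move: lte; rewrite -{1}(submK lei) mdegD mdeg1 addn1.
Qed.

Lemma support_ideal_is_ideal (P : 'X_{1..k} -> Prop) :
  (forall m i, P m -> P (m + U_(i))%MM) -> is_ideal (support_ideal P).
Proof.
move=> upP; split.
- by move=> m; rewrite msupp0.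
- move=> f g If Ig m /msuppD_le; rewrite mem_cat => /orP [|]; [exact: If|exact: Ig].
- move=> f g Ig m /msuppM_le /allpairsP [[m1 m2] /= [_ /Ig Pm2 ->]].
  by rewrite addmC; exact: up_closed_add.
Qed.

Lemma support_ideal_mon (P : 'X_{1..k} -> Prop) m :
  support_ideal P 'X_[m] <-> P m.
Proof.
split=> [|Pm m']; first by apply; rewrite msuppX inE.
by rewrite msuppX inE => /eqP ->.
Qed.

Lemma ideal_gen_is_ideal (A : comNzRingType) (X : set A) : is_ideal (ideal_gen X).
Proof.
split.
- by move=> J [[J0 _ _] _].
- by move=> f g If Ig J JX; case: (JX) => -[_ JD _] _; apply: JD; [exact: If|exact: Ig].
- by move=> f g Ig J JX; case: (JX) => -[_ _ JM] _; apply: JM; exact: Ig.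
Qed.

Lemma ideal_sum (A : comNzRingType) (I : set A) (T : eqType) (r : seq T) (F : T -> A) :
  is_ideal I -> (forall x, x \in r -> I (F x)) -> I (\sum_(x <- r) F x).
Proof.
move=> [I0 ID _] IF; rewrite big_seq; apply: big_ind => //.
Qed.

Lemma ideal_of_support (I : set R) f : is_ideal I ->
  (forall m, m \in msupp f -> I 'X_[m]) -> I f.
Proof.
move=> idI If; rewrite [f]mpolyE; apply: ideal_sum => // m /If Im.
by case: idI => _ _ IM; rewrite -mul_mpolyC; exact: IM.
Qed.

Lemma support_ideal_gen (P : 'X_{1..k} -> Prop) :
  (forall m i, P m -> P (m + U_(i))%MM) ->
  support_ideal P = ideal_gen [set 'X_[m] | m in [set m | P m]].
Proof.
move=> upP; apply/seteqP; split=> f.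
  move=> Pf; apply: ideal_of_support; first exact: ideal_gen_is_ideal.
  by move=> m /Pf Pm J [_]; apply; exists m.
apply; split; first exact: support_ideal_is_ideal.
by move=> _ [m Pm <-]; apply/support_ideal_mon.
Qed.

(** The polynomials whose monomials all lie in the generated ideal form an ideal containing the
    generators; minimality gives one inclusion. *)
Lemma monomial_ideal_support (X : set 'X_{1..k}) :
  ideal_gen [set 'X_[m] | m in X] =
  support_ideal (fun m => ideal_gen [set 'X_[m] | m in X] ('X_[m] : R)).
Proof.
set I := ideal_gen _; have idI : is_ideal I := ideal_gen_is_ideal _.
apply/seteqP; split=> f; last exact: ideal_of_support.
apply; split.
  apply: support_ideal_is_ideal => m i Im; rewrite mpolyXD mulrC.
  by case: idI => _ _; apply.
by move=> _ [m Xm <-]; apply/support_ideal_mon => J [_]; apply; exists m.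
Qed.

End MonomialIdeals.

Section StableIdeals.
Variables (K : fieldType) (n : nat).
Local Notation R := {mpoly K[n.+1]}.

Definition list_ideal (S : pred (seq nat)) : set R :=
  support_ideal (fun m => S (exponents m)).

(** Together with [list_ideal] this is a bijection between saturated strongly stable ideals and
    [ssat] predicates, the latter up to their values on lists of length [n + 1]. *)
Definition ideal_list (I : set R) : pred (seq nat) :=
  fun s => `[< I 'X_[monomial_of n.+1 s] >].

Lemma ssat_exponents_up S (m : 'X_{1..n.+1}) i : ssat n S ->
  S (exponents m) -> S (exponents (m + U_(i))%MM).
Proof.
move=> sS Sm; rewrite exponents_incr; apply: (ssat_up sS _ _ Sm).
  exact: size_exponents.
by rewrite -ltnS ltn_ord.
Qed.

Lemma list_ideal_mon S m : list_ideal S 'X_[m] <-> S (exponents m).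
Proof. exact: support_ideal_mon. Qed.

Lemma list_idealK S s : size s = n.+1 -> ideal_list (list_ideal S) s = S s.
Proof.
move=> ss; apply/asboolP/idP => [/list_ideal_mon|Ss].
  by rewrite monomial_ofK.
by apply/list_ideal_mon; rewrite monomial_ofK.
Qed.

Lemma list_ideal_stable S : ssat n S -> strongly_stable (list_ideal S).
Proof.
move=> sS; split.
  exists [set m | S (exponents m)]; apply: support_ideal_gen => m i.
  exact: ssat_exponents_up.
move=> m i j /list_ideal_mon Sm mj ltij; apply/list_ideal_mon.
have lej : (U_(j) <= m)%MM by rewrite lep1mP -lt0n.
rewrite exponents_incr; apply: (ssat_move sS (j := j)) => //.
- exact: size_exponents.
- by rewrite -ltnS ltn_ord.
- by rewrite -exponents_incr submK.
Qed.

(** Some [x_n^e] carries [f] into the ideal, and [ssat_sat] cancels its factors one by one on each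
    monomial of [f]. *)
Lemma list_ideal_saturated S : ssat n S -> saturated (list_ideal S).
Proof.
move=> sS; apply/seteqP; split=> f; last first.
  move=> If; exists 0%N => g _.
  have [_ _] := support_ideal_is_ideal K (fun m i => @ssat_exponents_up S m i sS); apply.
  exact: If.
move=> [e If] m mf; pose x := (U_(@ord_max n) *+ e)%MM.
have {If} : list_ideal S ('X_[x] * f).
  by apply: If => J [_]; apply; exists x => //=; rewrite mdegMn mdeg1 mul1n.
rewrite mulrC => /(_ (x + m)%MM); rewrite mcoeff_msupp mcoeffMX -mcoeff_msupp addmC.
move=> /(_ mf); rewrite {}/x; elim: e => [|e IH]; first by rewrite mulm0n addm0.
rewrite mulmSr addmA exponents_incr => /(ssat_sat sS) Se.
by apply: IH; apply: Se; exact: size_exponents.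
Qed.

(** For the last field, [m x_n] in [I] gives [m x_i] in [I] for all [i] by stability, so [m] lies in
    the saturation. *)
Lemma ideal_list_ssat I : strongly_stable I -> saturated I -> ssat n (ideal_list I).
Proof.
move=> [[X EI] stI] satI; have idI : is_ideal I by rewrite EI; exact: ideal_gen_is_ideal.
have up (m : 'X_{1..n.+1}) i : I 'X_[m] -> I 'X_[m + U_(i)].
  by case: idI => _ _ IM Im; rewrite mpolyXD mulrC; exact: IM.
have move_ (m : 'X_{1..n.+1}) (i j : 'I_n.+1) : (i < j)%N ->
    I 'X_[m + U_(j)] -> I 'X_[m + U_(i)].
  move=> ltij Im; rewrite -[m](addmK U_(j)); apply: stI => //.
  by rewrite mnmDE mnm1E eqxx addn1.
split.
- move=> m i _ lei /asboolP Im; apply/asboolP; rewrite -ltnS in lei.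
  by rewrite (monomial_of_incr m (Ordinal lei)); exact: up.
- move=> m i j _ ltij lej; rewrite -ltnS in lej; have lei := ltn_trans ltij lej.
  move=> /asboolP; rewrite (monomial_of_incr m (Ordinal lej)) => Im; apply/asboolP.
  by rewrite (monomial_of_incr m (Ordinal lei)); apply: move_ Im.
- move=> m _ /asboolP; rewrite (monomial_of_incr m (@ord_max n)) => Im; apply/asboolP.
  rewrite -satI; exists 1%N => g.
  (* The colon ideal of [I] by the monomial contains all variables, hence the irrelevant ideal. *)
  move=> /(_ [set h : R | I (h * 'X_[monomial_of n.+1 m])]); apply.
  split.
    case: idI => I0 ID IM; split=> [|f h|f h]; rewrite /= ?mul0r ?mulrDl //; first exact: ID.
    by rewrite -mulrA; exact: IM.
  move=> _ [m' /= dm' <-]; rewrite -mpolyXD addmC.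
  have /existsP [i /eqP ->] : [exists i, m' == U_(i)%MM] by rewrite -mdeg_eq1 dm'.
  have := ltn_ord i; rewrite ltnS leq_eqVlt => /orP [/eqP Ei|lti].
    by rewrite (_ : i = ord_max) //; exact: val_inj.
  exact: move_ Im.
Qed.

Lemma ideal_listK I : strongly_stable I -> list_ideal (ideal_list I) = I.
Proof.
move=> [[X EI] _]; rewrite [RHS]EI monomial_ideal_support -EI.
rewrite /list_ideal; congr support_ideal; apply: funext => m.
by rewrite /ideal_list asboolE exponentsK.
Qed.

(** * Dimensions of graded pieces *)

Definition monomials_mnm t : seq 'X_{1..n.+1} :=
  [seq monomial_of n.+1 s | s <- monomials n t].

Lemma mem_monomials_mnm t m : (m \in monomials_mnm t) = (mdeg m == t).
Proof.
apply/mapP/eqP => [[s + ->]|dm].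
  rewrite mem_monomials => /andP [/eqP ss /eqP <-].
  by rewrite -sumn_exponents monomial_ofK.
exists (exponents m); last by rewrite exponentsK.
by rewrite mem_monomials size_exponents sumn_exponents dm !eqxx.
Qed.

Lemma uniq_monomials_mnm t : uniq (monomials_mnm t).
Proof.
rewrite map_inj_in_uniq ?uniq_monomials // => s s'.
rewrite !mem_monomials => /andP [/eqP ss _] /andP [/eqP ss' _] E.
by rewrite -(monomial_ofK ss) E monomial_ofK.
Qed.

Lemma span_monomials t (ms : seq 'X_{1..n.+1}) :
  uniq ms -> (forall m, m \in ms -> mdeg m = t) ->
  exists2 U : {vspace dhomog n.+1 K t}, \dim U = size ms &
    forall f : dhomog n.+1 K t, f \in U <-> {subset msupp (mpoly_of_dhomog f) <= ms}.
Proof.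
move=> ums dms.
(* The default [0] is never reached on [ms], whose members have degree [t]. *)
pose X m : dhomog n.+1 K t := insubd 0 ('X_[m] : R).
have valX m : m \in ms -> mpoly_of_dhomog (X m) = 'X_[m].
  by move=> /dms dm; apply: (insubdK (0 : dhomog n.+1 K t)); rewrite -topredE /= dhomogX /= dm.
pose B := [seq X m | m <- ms].
have val_comb (c : 'I_(size B) -> K) :
    mpoly_of_dhomog (\sum_(i < size B) c i *: B`_i) =
    \sum_(i < size B) c i *: 'X_[nth 0%MM ms i].
  rewrite raddf_sum; apply: eq_bigr => i _; congr (_ *: _).
  have lti : (i < size ms)%N by rewrite -(size_map X).
  by rewrite -valX ?mem_nth // (nth_map 0%MM).
have coef_comb (c : 'I_(size B) -> K) (i : 'I_(size B)) :
    (\sum_(j < size B) c j *: 'X_[nth 0%MM ms j] : R)@_(nth 0%MM ms i) = c i.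
  rewrite raddf_sum (bigD1 i) //= mcoeffZ mcoeffX eqxx mulr1 big1 ?addr0 //.
  have lts (l : 'I_(size B)) : (l < size ms)%N by rewrite -(size_map X).
  by move=> j neji; rewrite mcoeffZ mcoeffX nth_uniq ?lts // val_eqE (negPf neji) mulr0.
have freeB : free B.
  rewrite -[B]/(val (in_tuple B)); apply/freeP => c c0 i.
  by rewrite -(coef_comb c i) -val_comb c0; exact: mcoeff0.
exists <<B>>%VS; first by rewrite (eqP freeB) size_map.
move=> f; split=> [/(coord_span (X := in_tuple B)) -> m|fms].
  rewrite val_comb => /msupp_sum_le /flatten_mapP [i _] /msuppZ_le.
  by rewrite msuppX inE => /eqP ->; rewrite mem_nth // -(size_map X) ltn_ord.
have -> : f = \sum_(m <- ms) f@_m *: X m.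
  apply: val_inj; rewrite raddf_sum /=.
  transitivity (\sum_(m <- ms) f@_m *: 'X_[m] : R); last first.
    by rewrite !big_seq; apply: eq_bigr => m /valX <-.
  apply/mpolyP => m; rewrite raddf_sum /=.
  have [mms|mNms] := boolP (m \in ms).
    rewrite (bigD1_seq m) //= mcoeffZ mcoeffX eqxx mulr1 big1 ?addr0 // => m' /negPf nem.
    by rewrite mcoeffZ mcoeffX nem mulr0.
  rewrite memN_msupp_eq0; last by apply: contra mNms; exact: fms.
  rewrite big_seq big1 // => m' m'ms; rewrite mcoeffZ mcoeffX.
  by case: eqVneq m'ms mNms => [->->|]; rewrite ?mulr0.
rewrite big_seq; apply: memv_suml => m mms; apply: memvZ; apply: memv_span.
exact: map_f.
Qed.

Lemma hilbert_function_list_ideal S t : ssat n S ->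
  hilbert_function (list_ideal S) t = std_count n S t.
Proof.
move=> sS; pose ms := [seq m <- monomials_mnm t | S (exponents m)].
have [||T dimT memT] := @span_monomials t (monomials_mnm t).
- exact: uniq_monomials_mnm.
- by move=> m; rewrite mem_monomials_mnm => /eqP.
have {memT} ET : T = fullv.
  apply/vspaceP => f; rewrite memvf; apply/memT => m mf.
  by rewrite mem_monomials_mnm (dhomog_mf (dhomog_is_dhomog f) mf).
have [||U dimU memU] := @span_monomials t ms.
- by rewrite filter_uniq ?uniq_monomials_mnm.
- by move=> m; rewrite mem_filter mem_monomials_mnm => /andP [_ /eqP].
have {}memU (f : dhomog n.+1 K t) : f \in U <-> list_ideal S (mpoly_of_dhomog f).
  rewrite memU; split=> [fms m /fms|If m mf]; first by rewrite mem_filter => /andP [].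
  by rewrite mem_filter If // mem_monomials_mnm (dhomog_mf (dhomog_is_dhomog f) mf) /=.
(* [U] satisfies the condition defining the graded piece, and that condition determines a
   subspace. *)
have EU : graded_piece (list_ideal S) t = U.
  have memG := xgetPex 0%VS (ex_intro (fun V : {vspace dhomog n.+1 K t} =>
    forall f : dhomog n.+1 K t, f \in V <-> list_ideal S (mpoly_of_dhomog f)) U memU).
  by apply/vspaceP => f; apply/idP/idP => [/memG/memU|/memU/memG].
rewrite /hilbert_function -ET dimT EU dimU /std_count !size_map size_filter count_map.
rewrite -(count_predC S (monomials n t)).
rewrite [X in (_ - X)%N](eq_in_count (a2 := S)) ?addKn // => s.
by rewrite mem_monomials /= => /andP [/eqP ss _]; rewrite monomial_ofK.
Qed.

End StableIdeals.
Arguments list_ideal : clear implicits.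

(** * Counting stable ideals *)

(** Encodes the ideal generated by [x_0] and by the ideal of [S] with its variables renumbered from
    [1]. *)
Definition add_linear (S : pred (seq nat)) : pred (seq nat) :=
  fun s => (0 < head 0 s)%N || S (behead s).

Lemma ssat_add_linear n S : ssat n S -> ssat n.+1 (add_linear S).
Proof.
move=> sS; split=> -[//|a m].
- case=> [|i] [sm] lei //; rewrite /add_linear /= => /orP [->//|Sm].
  by rewrite (ssat_up sS sm lei Sm) orbT.
- case=> [|i] [|j] //= [sm] lti lej; rewrite /add_linear //= => /orP [->//|Sm].
  by rewrite (ssat_move (i := i) (j := j) sS sm lti lej Sm) orbT.
- by case=> sm; rewrite /add_linear /= => /orP [->//|/(ssat_sat sS sm) ->]; rewrite orbT.
Qed.

Lemma std_count_add_linear n S t : std_count n.+1 (add_linear S) t = std_count n S t.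
Proof.
rewrite std_count_slice big_nat_recl // big1 ?addn0 ?subn0 // => a _.
by apply: std_count_full.
Qed.

Lemma ssat_all2 n (S : pred (seq nat)) s s' : ssat n S -> size s' = n.+1 ->
  all2 leq s s' -> S s -> S s'.
Proof.
elim: n S s s' => [|n IH] S [|a s] [|a' s'] //= sS [ss'] /andP [lea les] Ss.
  by case: s' ss' s les Ss => // _ [|//] _; exact: (ssat_head sS _ lea).
apply: (ssat_head sS ss' lea); exact: (IH (slice S a) s _ (ssat_slice a sS)).
Qed.

Section Counting.
Variables (K : fieldType) (p : {poly rat}) (d : nat) (b : 'I_d.+1 -> int).
Hypothesis p_form : p = \sum_(i < d.+1) level_poly i (b i).

Definition stable_ideals (n : nat) : set (set {mpoly K[n.+1]}) :=
  [set I | [/\ strongly_stable I, saturated I & quotient_hilbert_poly I p]].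

Arguments stable_ideals : clear implicits.

Lemma stable_idealsP n I : stable_ideals n I <->
  exists S, [/\ ssat n S, I = list_ideal K n S &
    exists t0, forall t, (t0 <= t)%N -> p.[t%:R] = (std_count n S t)%:R].
Proof.
split=> [[stI satI [t0 hI]]|[S [sS -> [t0 hS]]]].
  have sS := ideal_list_ssat stI satI.
  exists (ideal_list I); split=> //; first by rewrite ideal_listK.
  exists t0 => t /hI ->; congr (_%:R).
  by rewrite -(hilbert_function_list_ideal K t sS) ideal_listK.
split; [exact: list_ideal_stable|exact: list_ideal_saturated|].
by exists t0 => t /hS ->; rewrite hilbert_function_list_ideal.
Qed.

Lemma list_ideal_inj n S S' : list_ideal K n S = list_ideal K n S' ->
  forall s, size s = n.+1 -> S s = S' s.
Proof. by move=> E s ss; rewrite -(list_idealK K S ss) E list_idealK. Qed.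

Lemma eq_list_ideal n S S' : (forall s, size s = n.+1 -> S s = S' s) ->
  list_ideal K n S = list_ideal K n S'.
Proof.
by move=> E; congr support_ideal; apply: funext => m; rewrite E ?size_exponents.
Qed.

(** Cone degrees lie below the number of cones, which is at most [b_0]. By [cone_gens] each ideal is
    then determined by its monomials of degree at most [b_0], a subset of a finite set. *)
Lemma finite_stable_ideals n : finite_set (stable_ideals n).
Proof.
pose B := `|b ord0|%N.
pose low (I : set {mpoly K[n.+1]}) : {set 'X_{1..n.+1 < B.+1}} :=
  [set m : 'X_{1..n.+1 < B.+1} | ideal_list I (exponents m)]%SET.
suff low_inj : {in stable_ideals n &, injective low}.
  by rewrite -(eq_finite_set (inj_card_eq low_inj)); exact: finite_finset.
have low_sub S S' : ssat n S -> ssat n S' ->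
    (exists t0, forall t, (t0 <= t)%N -> p.[t%:R] = (std_count n S t)%:R) ->
    low (list_ideal K n S) = low (list_ideal K n S') ->
    forall s, size s = n.+1 -> S s -> S' s.
  move=> sS sS' [t0 hS] Elow s ss Ss.
  have [L dL] := ssat_cone_decomposition sS.
  have [leL _] := level_form_cone_bound dL hS p_form.
  have [x Lx|s' [Ss' les' s's]] := cone_gens dL (B := B) _ ss Ss.
    apply: leq_trans (size_gt_gap_free (cone_gap_free dL) Lx) _.
    by rewrite -lez_nat; apply: le_trans leL _; rewrite abszE ler_norm.
  have ss' : size s' = n.+1.
    by rewrite -ss; move: s's; rewrite all2E => /andP [/eqP].
  apply: (ssat_all2 sS' ss s's).
  have ltm : (mdeg (monomial_of n.+1 s') < B.+1)%N.
    by rewrite -sumn_exponents monomial_ofK.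
  move/setP: Elow => /(_ (BMultinom ltm)); rewrite !inE /=.
  by rewrite monomial_ofK // !list_idealK // Ss' => <-.
move=> I I' /set_mem /stable_idealsP [S [sS -> hS]] /set_mem /stable_idealsP [S' [sS' -> hS']].
move=> Elow; apply: eq_list_ideal => s ss.
by apply/idP/idP; apply: low_sub.
Qed.

(** Adjoining [x_0] is injective and keeps the Hilbert polynomial; it is surjective because the
    hypothesis forces [x_0] into every ideal of the larger ring. *)
Lemma card_stable_idealsS n : b ord0 + d%:Z <= n.+1%:Z ->
  stable_ideals n.+1 #= stable_ideals n.
Proof.
move=> le_bn.
pose f I := list_ideal K n.+1 (add_linear (@ideal_list K n I)).
have f_list S : f (list_ideal K n S) = list_ideal K n.+1 (add_linear S).
  apply: eq_list_ideal => -[//|a s] [ss]; rewrite /add_linear /=.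
  by rewrite list_idealK.
have f_inj : {in stable_ideals n &, injective f}.
  move=> I I' /set_mem /stable_idealsP [S [_ -> _]] /set_mem /stable_idealsP [S' [_ -> _]].
  rewrite !f_list => /list_ideal_inj E; apply: eq_list_ideal => s ss.
  by have := E (0%N :: s); rewrite /add_linear /= ss; apply.
suff <- : f @` stable_ideals n = stable_ideals n.+1 by exact: inj_card_eq.
apply/seteqP; split=> [_ [I /stable_idealsP [S [sS -> [t0 hS]]] <-]|I].
  rewrite f_list; apply/stable_idealsP; exists (add_linear S); split=> //.
    exact: ssat_add_linear.
  by exists t0 => t /hS ->; rewrite std_count_add_linear.
move=> /stable_idealsP [S [sS -> [t0 hS]]].
have [L dL] := ssat_cone_decomposition sS.
have [leL led] := level_form_cone_bound dL hS p_form.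
have S1 : S (1%N :: nseq n.+1 0%N).
  apply: (linear_form_of_cone_bound sS dL led).
  by rewrite -lez_nat PoszD; apply: le_trans le_bn; rewrite lerD2r.
have ES s : size s = n.+2 -> S s = add_linear (slice S 0) s.
  case: s => // -[//|a] s [ss]; rewrite /add_linear /=.
  by apply: (ssat_tail sS ss); apply: (ssat_head sS _ _ S1) => //; rewrite size_nseq.
(* The preimage is the image of the ideal under [x_0 = 0]. *)
exists (list_ideal K n (slice S 0)); last by rewrite f_list; apply/esym/eq_list_ideal.
apply/stable_idealsP; exists (slice S 0); split=> //; first exact: ssat_slice.
by exists t0 => t /hS ->; rewrite (eq_std_count _ ES) std_count_add_linear.
Qed.

End Counting.

Arguments stable_ideals : clear implicits.

Theorem proposition7p3 (K : fieldType) (p : {poly rat}) (d : nat)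
    (b : 'I_d.+1 -> int)
    (p_neq0 : p != 0)
    (p_hilbert : is_hilbert_poly K p)
    (p_degree : size p = d.+1)
    (b_noninc : forall i j : 'I_d.+1, (i <= j)%N -> b j <= b i)
    (b_last_gt0 : 0 < b ord_max)
    (p_form : p = \sum_(i < d.+1)
       (binomial_poly ('X + (i : nat)%:R%:P) i.+1
        - binomial_poly ('X + (i : nat)%:R%:P - (b i)%:~R%:P) i.+1)) :
  exists N : nat, forall n : nat, b ord0 + d%:Z - 1 <= n%:Z ->
    [set I : set {mpoly K[n.+1]} |
      [/\ strongly_stable I, saturated I & quotient_hilbert_poly I p]]
    #= `I_N.
Proof.
(* As [b ord0 > 0], the absolute value changes nothing and [n0] is the least admissible [n]; [N] is
   the count there. *)
pose n0 := `|(b ord0 + d%:Z - 1)%R|%N.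
have b0_gt0 : 0 < b ord0 by apply: lt_le_trans b_last_gt0 _; exact: b_noninc.
have n0E : n0%:Z = b ord0 + d%:Z - 1 by rewrite /n0; lia.
have /finite_setP [N cardN] := finite_stable_ideals K p_form n0.
have card_k k : stable_ideals K p (n0 + k) #= `I_N.
  elim: k => [|k IH]; first by rewrite addn0.
  rewrite addnS; apply: card_eq_trans IH; apply: (card_stable_idealsS K p_form).
  by rewrite -addn1 !PoszD n0E; lia.
by exists N => n; rewrite -n0E lez_nat => /subnKC <-; exact: card_k.
Qed.
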